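(* Let $$A=\begin{bmatrix} 0 & 1 & 0 & 0 & 0 & 0\\ 1.000002542612694 & 0 & 0 & 2 & 0 & 0\\ 0 & 0 & 0 & 1 & 0 & 0\\ 0 & -0.000294117647059 & 0 & 0 & 0 & 0\\ 0 & 0 & 0 & 0 & 0 & 1\\ 0 & 0 & 0 & 0 & -0.00000127311747 & 0 \end{bmatrix}\in\mathbb{R}^{6\times 6},$$ where the decimal entries are read as exact rational numbers. Let $e_1,\dots,e_6$ be the standard basis (column) vectors of $\mathbb{R}^6$, and put $b_r=e_2$, $b_\theta=e_4$, $b_z=e_6$. For each nonempty subset $S\subseteq\{r,\theta,z\}$ let $B_S$ be the $6\times |S|$ matrix whose columns are the vectors $b_i$, $i\in S$, and consider the linear time-invariant control system $$\dot X(t)=AX(t)+B_S\,U(t),\qquad X(t)\in\mathbb{R}^6,\ U(t)\in\mathbb{R}^{|S|}.$$ Then: (1) for $S=\{r\}$ the system is not controllable; (2) for $S=\{\theta\}$ the system is not controllable; (3) for $S=\{z\}$ the system is not controllable; (4) for $S=\{r,\theta\}$ the system is not controllable; (5) for $S=\{r,z\}$ the system is not controllable; (6) for $S=\{\theta,z\}$ the system is controllable; (7) for $S=\{r,\theta,z\}$ the system is controllable.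
   Context: Controllability: for $t_0<t_1$, the system $\dot X(t)=AX(t)+BU(t)$ with $A\in\mathbb{R}^{n\times n}$, $B\in\mathbb{R}^{n\times m}$ is controllable over $[t_0,t_1]$ if for each pair $x_0,x_1\in\mathbb{R}^n$ there is a control $U\in L^2([t_0,t_1],\mathbb{R}^m)$ such that the solution with $X(t_0)=x_0$ satisfies $X(t_1)=x_1$, i.e. $x_1=e^{A(t_1-t_0)}x_0+\int_{t_0}^{t_1}e^{A(t_1-s)}BU(s)\,ds$. ''Controllable'' without mention of an interval means controllable over every interval $[t_0,t_1]$ with $t_0<t_1$; by time invariance and the Kalman rank condition this is equivalent to controllability over any single such interval. Origin of the system: it is the linearization at the origin of the equations of motion, in cylindrical coordinates $(r,\theta,z)$, of an artificial satellite under the zonal harmonic $J_2$ of the oblate Earth, in the state variables $X_1=r-\sigma$, $X_2=\dot r$, $X_3=\sigma(\theta-\omega t)$, $X_4=\sigma(\dot\theta-\omega)$, $X_5=z$, $X_6=\dot z$, where $\sigma$ is the radius of a circular reference orbit and $\omega$ its angular velocity. The set $S$ records the directions in which thrusters (controls) are applied: a thruster in the $r$, $\theta$ or $z$ direction enters additively in the equation for $\dot X_2$, $\dot X_4$ or $\dot X_6$ respectively. *)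

(* Defs.v *)
From HB Require Import structures.
From mathcomp Require Import all_boot all_order all_algebra.
From mathcomp Require Import all_classical all_reals all_analysis.

Set Implicit Arguments.
Unset Strict Implicit.
Unset Printing Implicit Defensive.

Import Order.TTheory GRing.Theory Num.Theory.
Import numFieldNormedType.Exports.

Local Open Scope classical_set_scope.
Local Open Scope ring_scope.

Definition expmx (R : realType) (n : nat) (M : 'M[R]_n) : 'M[R]_n :=
  limn (series (fun k : nat => (k`!%:R)^-1 *: M ^+ k)).

(* Square integrability on [a, b] is required of each component, which amounts
   to that of the Euclidean norm. Functions are not identified up to
   almost-everywhere equality. *)
Definition L2_control (R : realType) (m : nat) (a b : R)
    (U : R -> 'cV[R]_m) : Prop :=
  forall i : 'I_m,
    measurable_fun `[a, b] (fun t => U t i ord0) /\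
    (@lebesgue_measure R).-integrable `[a, b]
      (fun t => ((U t i ord0) ^+ 2)%:E).

Definition integral_cV (R : realType) (n : nat) (a b : R)
    (f : R -> 'cV[R]_n) : 'cV[R]_n :=
  \col_(i < n) (\int[@lebesgue_measure R]_(s in `[a, b]) f s i ord0)%R.

(* The solution at time t >= t0 of X' = A X + B U with X(t0) = x0, given by the
   variation-of-constants formula. *)
Definition solution (R : realType) (n m : nat) (A : 'M[R]_n) (B : 'M[R]_(n, m))
    (t0 : R) (x0 : 'cV[R]_n) (U : R -> 'cV[R]_m) (t : R) : 'cV[R]_n :=
  expmx ((t - t0) *: A) *m x0 +
  integral_cV t0 t (fun s => expmx ((t - s) *: A) *m (B *m U s)).

Definition controllable_on (R : realType) (n m : nat) (A : 'M[R]_n)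
    (B : 'M[R]_(n, m)) (t0 t1 : R) : Prop :=
  forall x0 x1 : 'cV[R]_n,
    exists U : R -> 'cV[R]_m,
      L2_control t0 t1 U /\ solution A B t0 x0 U t1 = x1.

Definition controllable (R : realType) (n m : nat) (A : 'M[R]_n)
    (B : 'M[R]_(n, m)) : Prop :=
  forall t0 t1 : R, t0 < t1 -> controllable_on A B t0 t1.

Inductive direction : Type := dir_r | dir_theta | dir_z.

Definition ord_of_direction (d : direction) : 'I_3 :=
  match d with
  | dir_r => inord 0
  | dir_theta => inord 1
  | dir_z => inord 2
  end.

Definition direction_of_ord (i : 'I_3) : direction :=
  match nat_of_ord i with
  | 0 => dir_r
  | 1 => dir_theta
  | _ => dir_z
  end.

Lemma ord_of_directionK : cancel ord_of_direction direction_of_ord.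
Proof. by case; rewrite /direction_of_ord /= inordK. Qed.

HB.instance Definition _ := Equality.copy direction (can_type ord_of_directionK).
HB.instance Definition _ := Choice.copy direction (can_type ord_of_directionK).
HB.instance Definition _ := Countable.copy direction (can_type ord_of_directionK).
HB.instance Definition _ := Finite.copy direction (can_type ord_of_directionK).

(* Rows and columns are counted from 0. The decimal entries
   1.000002542612694, -0.000294117647059 and -0.00000127311747 are written in
   groups of three digits, since a literal with that many digits would be a
   huge unary natural number. *)
Definition satA (R : realType) : 'M[R]_6 :=
  \matrix_(i < 6, j < 6)
    match nat_of_ord i, nat_of_ord j with
    | 0, 1 => 1
    | 1, 0 => 1 + 2 / 10 ^+ 6 + 542 / 10 ^+ 9 + 612 / 10 ^+ 12 + 694 / 10 ^+ 15
    | 1, 3 => 2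
    | 2, 3 => 1
    | 3, 1 => - (294 / 10 ^+ 6 + 117 / 10 ^+ 9 + 647 / 10 ^+ 12 + 59 / 10 ^+ 15)
    | 4, 5 => 1
    | 5, 4 => - (1 / 10 ^+ 6 + 273 / 10 ^+ 9 + 117 / 10 ^+ 12 + 470 / 10 ^+ 15)
    | _, _ => 0
    end.

Definition thrust_vector (R : realType) (d : direction) : 'cV[R]_6 :=
  match d with
  | dir_r => delta_mx (inord 1) ord0
  | dir_theta => delta_mx (inord 3) ord0
  | dir_z => delta_mx (inord 5) ord0
  end.

Definition satB (R : realType) (S : {set direction}) : 'M[R]_(6, #|S|) :=
  \matrix_(i < 6, j < #|S|) thrust_vector R (enum_val j) i ord0.

(* Main.v *)
Require Import Defs.
From mathcomp Require Import all_boot all_order all_algebra.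
From mathcomp Require Import all_classical all_reals all_analysis.
From mathcomp Require Import lra.

Set Implicit Arguments.
Unset Strict Implicit.
Unset Printing Implicit Defensive.

Import Order.TTheory GRing.Theory Num.Theory.
Import numFieldNormedType.Exports.

Local Open Scope classical_set_scope.
Local Open Scope ring_scope.

(** Controllability of a linear system is decided by the Kalman condition, in
    dual form: the system is controllable exactly when no nonzero row vector
    [v] satisfies [v A^k B = 0] for all [k] ([controllableP]).

    - If such a [v] exists, then [v e^(tA) B = 0] for all [t], because each
      term of the exponential series vanishes; so [v] annihilates every state
      reachable from the origin.
    - If none exists, then the reachability Gramian, the integral of
      [E(s) E(s)^T] with [E(s) = e^((t1-s)A) B], is invertible. Indeed a vector
      [v] of its left kernel makes the integral of the continuous function
      [|v E(s)|^2] vanish, hence [v E(s) = 0] on the open interval; repeated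
      differentiation gives [v A^k E(s) = 0] there, and at the limit [s = t1]
      this reads [v A^k B = 0]. The control [E(s)^T y], with [y] solving a
      linear system whose matrix is the Gramian, then reaches any target.

    Differentiation of the exponential is done entrywise: every entry of
    [P e^(tA) Q] is a power series in [t], and formal differentiation of that
    series replaces [P] by [P A] ([is_derive_expmx]).

    For the satellite, two quantities obstruct controllability. Without a
    thruster in the theta direction, [X4 + c X1] is conserved, where [-c] is the
    entry of [A] in row 4 and column 2 (this is linearized angular momentum).
    Without a thruster in the z direction, [(X5, X6)] is a free harmonic
    oscillator. With both thrusters, reading the rows [v A^k] coordinate by
    coordinate forces [v = 0] since the entry of [A] in row 2 and column 1 is
    not zero. *)

(** * The exponential of a matrix *)

Lemma cvg_mx (R : realType) (m n : nat) (u : nat -> 'M[R]_(m, n))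
    (L : 'M[R]_(m, n)) :
  (forall i j, u k i j @[k --> \oo] --> L i j) -> u @ \oo --> L.
Proof.
move=> uL; apply/cvg_mx_entourageP => E entE.
apply: filter_forall => i; apply: filter_forall => j.
have /cvg_entourageP := uL i j; move=> /(_ _ entE).
rewrite !near_simpl; apply: filterS => k /=.
by rewrite inE.
Qed.

Lemma normr_expr_mx_le (R : realType) (n : nat) (M : 'M[R]_n) (k : nat) i j :
  `|(M ^+ k) i j| <= (\sum_i0 \sum_j0 `|M i0 j0|) ^+ k.
Proof.
set C := \sum_i0 _.
have C0 : 0 <= C by apply: sumr_ge0 => ? _; apply: sumr_ge0.
have rowC l : \sum_j0 `|M l j0| <= C.
  by rewrite /C [leRHS](bigD1 l)//= lerDl sumr_ge0// => ? _; apply: sumr_ge0.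
elim: k i j => [|k IH] i j.
  by rewrite !expr0 mxE; case: (i == j); rewrite ?normr1// normr0.
rewrite !exprS -mulmxE mxE (le_trans (ler_norm_sum _ _ _))//.
apply: (@le_trans _ _ (\sum_j0 `|M i j0| * C ^+ k)).
  by apply: ler_sum => l _; rewrite normrM ler_wpM2l.
by rewrite -mulr_suml ler_wpM2r ?exprn_ge0.
Qed.

(** The entries of [M ^+ k / k!] are dominated by the exponential series of the
    sum of the absolute values of the entries of [M]. *)
Lemma cvg_expmx (R : realType) (n : nat) (M : 'M[R]_n) :
  series (fun k : nat => (k`!%:R)^-1 *: M ^+ k) @ \oo --> expmx M.
Proof.
set u := fun k : nat => _.
have cvgu i j : cvgn (series (fun k => u k i j)).
  apply: normed_cvg.
  apply: series_le_cvg (is_cvg_series_exp_coeff (\sum_i0 \sum_j0 `|M i0 j0|)).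
  - by move=> k /=.
  - by move=> k; apply: exp_coeff_ge0; apply: sumr_ge0 => ? _; apply: sumr_ge0.
  - move=> k /=; rewrite /u mxE normrM mulrC /exp_coeff/=.
    by rewrite [`|_^-1|]ger0_norm ?invr_ge0// ler_wpM2r ?invr_ge0//
      normr_expr_mx_le.
suff uL : series u @ \oo --> (\matrix_(i, j) limn (series (fun k => u k i j))).
  by rewrite /expmx -/u (cvg_lim _ uL).
apply: cvg_mx => i j; rewrite mxE.
rewrite [X in X @ _ --> _](_ : _ = series (fun k => u k i j)) ?cvgu//.
by apply/funext => k; rewrite /series/= summxE.
Qed.

Lemma exprZn_mx (R : realType) (n : nat) (t : R) (A : 'M[R]_n) (k : nat) :
  (t *: A) ^+ k = t ^+ k *: A ^+ k.
Proof.
elim: k => [|k IH]; first by rewrite !expr0 scale1r.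
by rewrite !exprS IH -mulmxE -scalemxAl -scalemxAr scalerA.
Qed.

Lemma continuous_mulmx_entry (R : realType) (p q m n : nat)
    (P : 'M[R]_(p, m)) (Q : 'M[R]_(n, q)) i j :
  continuous (fun M : 'M[R]_(m, n) => (P *m M *m Q) i j).
Proof.
move=> M; have FF : Filter (nbhs M) by exact: nbhs_filter.
rewrite /continuous_at.
rewrite [X in X @ _ --> _](_ : _ = fun M : 'M[R]_(m, n) =>
  \sum_l (\sum_k P i k * M k l) * Q l j); last first.
  by apply/funext => N; rewrite mxE; apply: eq_bigr => l _; rewrite mxE.
rewrite [X in _ --> X](_ : _ = \sum_l (\sum_k P i k * M k l) * Q l j);
  last by rewrite mxE; apply: eq_bigr => l _; rewrite mxE.
apply: cvg_big => [|l _]; first exact: add_continuous.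
apply: cvgM; last exact: cvg_cst.
apply: cvg_big => [|k _]; first exact: add_continuous.
apply: cvgM; first exact: cvg_cst.
exact: coord_continuous.
Qed.

(** This turns questions on [e^(tA)] into questions on scalar power series. *)
Lemma cvg_pseries_expmx (R : realType) (p q n : nat) (A : 'M[R]_n)
    (P : 'M[R]_(p, n)) (Q : 'M[R]_(n, q)) i j (t : R) :
  pseries (fun k => (k`!%:R)^-1 * (P *m A ^+ k *m Q) i j) t @ \oo -->
    (P *m expmx (t *: A) *m Q) i j.
Proof.
have := cvg_comp _ _ (@cvg_expmx _ _ (t *: A)) (@continuous_mulmx_entry _ _ _ _
  _ P Q i j _).
apply: cvg_trans; apply: near_eq_cvg; apply: nearW => N /=.
rewrite /pseries /series/= mulmx_sumr mulmx_suml summxE.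
apply: eq_bigr => k _; rewrite exprZn_mx scalerA -scalemxAr -scalemxAl mxE.
by rewrite mulrAC.
Qed.

(** The coefficients [P A^k Q / k!] are shifted by formal differentiation,
    which multiplies the [k]-th one by [k] and so yields [P A A^k Q / k!]. *)
Lemma is_derive_expmx (R : realType) (p q n : nat) (A : 'M[R]_n)
    (P : 'M[R]_(p, n)) (Q : 'M[R]_(n, q)) i j (t : R) :
  is_derive t (1 : R) (fun t : R => (P *m expmx (t *: A) *m Q) i j)
    ((P *m A *m expmx (t *: A) *m Q) i j).
Proof.
pose c (P' : 'M[R]_(p, n)) k := (k`!%:R)^-1 * (P' *m A ^+ k *m Q) i j.
have limc P' s : limn (pseries (c P') s) = (P' *m expmx (s *: A) *m Q) i j.
  exact/cvg_lim/cvg_pseries_expmx.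
have diffc P' : pseries_diffs (c P') = c (P' *m A).
  apply/funext => k; rewrite /pseries_diffs /c factS natrM invfM mulrA.
  by rewrite mulVKf ?pnatr_eq0// exprS -mulmxE mulmxA.
have cvgc P' s : cvgn (pseries (c P') s).
  by apply/cvg_ex; eexists; exact: cvg_pseries_expmx.
rewrite -limc -diffc.
under eq_fun do rewrite -limc.
(* The series converge everywhere; any radius larger than [|t|] will do. *)
apply: (@pseries_snd_diffs _ _ (`|t| + 1)); rewrite ?diffc//.
by rewrite [ltRHS]ger0_norm ?addr_ge0// ltrDl.
Qed.

Lemma expmx0 (R : realType) (n : nat) (A : 'M[R]_n) : expmx (0 *: A) = 1%:M.
Proof.
apply/matrixP => i j; have := @cvg_pseries_expmx _ _ _ _ A 1%:M 1%:M i j 0.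
rewrite mul1mx mulmx1 => /cvg_lim <-//; apply/cvg_lim => //.
apply: cvg_near_cst; exists 1%N => // -[//|k] _.
rewrite /pseries /series/= big_nat_recl//= big1 ?addr0 => [|l _].
  by rewrite fact0 invr1 mul1r expr0 mulr1 mulmx1 mul1mx.
by rewrite expr0n mulr0.
Qed.

Lemma is_derive_expmx_backward (R : realType) (p q n : nat) (A : 'M[R]_n)
    (P : 'M[R]_(p, n)) (Q : 'M[R]_(n, q)) i j (t s : R) :
  is_derive s (1 : R) (fun s : R => (P *m expmx ((t - s) *: A) *m Q) i j)
    (- (P *m A *m expmx ((t - s) *: A) *m Q) i j).
Proof.
rewrite -mulrN1.
apply: (@is_derive1_comp _ (fun u => (P *m expmx (u *: A) *m Q) i j)
  (fun s => t - s)); first exact: is_derive_expmx.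
by apply: is_derive_eq; rewrite ?add0r mul1r.
Qed.

Lemma continuous_expmx_backward (R : realType) (p q n : nat) (A : 'M[R]_n)
    (P : 'M[R]_(p, n)) (Q : 'M[R]_(n, q)) i j (t : R) :
  continuous (fun s : R => (P *m expmx ((t - s) *: A) *m Q) i j).
Proof.
move=> s; apply: differentiable_continuous; apply/derivable1_diffP.
exact: (@ex_derive _ _ _ _ _ _ _ (is_derive_expmx_backward A P Q i j t s)).
Qed.

(** * Integration on a segment *)

Section Rintegral_linear_combination.
Context d (T : measurableType d) (R : realType).
Context (mu : {measure set T -> \bar R}) (D : set T).
Hypothesis mD : measurable D.

Lemma integrable_sumZ I (r : seq I) (c : I -> R) (g : I -> T -> R) :
  (forall i, mu.-integrable D (EFin \o g i)) ->
  mu.-integrable D (EFin \o (fun x => \sum_(i <- r) c i * g i x)).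
Proof.
move=> gi.
rewrite (_ : _ \o _ = fun x => (\sum_(i <- r) ((c i)%:E * (g i x)%:E))%E).
  by apply: integrable_sum => // i _; apply: integrableZl => //; exact: gi.
by apply/funext => x /=; rewrite -sumEFin.
Qed.

Lemma Rintegral_sumZ I (r : seq I) (c : I -> R) (g : I -> T -> R) :
  (forall i, mu.-integrable D (EFin \o g i)) ->
  \int[mu]_(x in D) (\sum_(i <- r) c i * g i x) =
  \sum_(i <- r) c i * \int[mu]_(x in D) g i x.
Proof.
move=> gi; elim: r => [|i r IH].
  under eq_Rintegral do rewrite big_nil.
  by rewrite big_nil Rintegral_cst// mul0r.
under eq_Rintegral do rewrite big_cons.
rewrite big_cons -IH RintegralD//; [|exact: (integrableZl mD (c i) (gi
  i))|exact: integrable_sumZ].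
by rewrite RintegralZl.
Qed.

End Rintegral_linear_combination.

Lemma continuous_integrable (R : realType) (a b : R) (f : R -> R) :
  continuous f -> (@lebesgue_measure R).-integrable `[a, b] (EFin \o f).
Proof.
move=> cf; apply: continuous_compact_integrable; first exact: segment_compact.
exact: continuous_subspaceT.
Qed.

Lemma integrable_continuousM (R : realType) (a b : R) (f g : R -> R) :
  continuous f -> (@lebesgue_measure R).-integrable `[a, b] (EFin \o g) ->
  (@lebesgue_measure R).-integrable `[a, b] (EFin \o (fun x => f x * g x)).
Proof.
move=> cf gi.
rewrite (_ : _ \o _ = ((EFin \o f) \* (EFin \o g))%E)//.
apply: integrableMr => //.
  by apply: measurable_funTS; exact:
    measurable_realfun.continuous_measurable_fun.
have /compact_bounded[M [Mr fM]] : compact (f @` `[a, b]).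
  apply: continuous_compact; last exact: segment_compact.
  exact: continuous_subspaceT.
by exists M; split => // N MN x xab; apply: fM => //; exists x.
Qed.

(** On a segment constants are integrable, and [|u| <= 1 + u^2]. *)
Lemma square_integrable_integrable (R : realType) (a b : R) (u : R -> R) :
  measurable_fun `[a, b] u ->
  (@lebesgue_measure R).-integrable `[a, b] (fun t => ((u t) ^+ 2)%:E) ->
  (@lebesgue_measure R).-integrable `[a, b] (EFin \o u).
Proof.
move=> mu u2.
have mab : measurable (`[a, b] : set (measurableTypeR R)) by [].
apply: (@le_integrable _ _ _ (@lebesgue_measure R) _ mab _
  (fun t => (1 + u t ^+ 2)%:E)).
- exact/measurable_realfun.measurable_EFinP.
- move=> t _; rewrite lee_fin [leRHS]ger0_norm ?addr_ge0 ?sqr_ge0//.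
  have := sqr_ge0 (`|u t| - 1); rewrite -(real_normK (num_real (u t))).
  by have := normr_ge0 (u t); nra.
- rewrite (_ : (fun _ => _) = ((EFin \o cst 1%R) \+ (fun t => ((u t) ^+
  2)%:E))%E)//.
  apply: integrableD => //.
  by apply: continuous_integrable => ?; exact: cvg_cst.
Qed.

(** The indefinite integral from [a] is nonnegative and bounded by the total
    integral, so it is constantly zero, and [f] is its derivative. *)
Lemma Rintegral_eq0_continuous (R : realType) (a b : R) (f : R -> R) :
  a < b -> continuous f -> (forall x, 0 <= f x) ->
  \int[@lebesgue_measure R]_(x in `[a, b]) f x = 0 ->
  {in `]a, b[, forall x, f x = 0}.
Proof.
move=> ab cf f0 intf0 x xab.
have fi y : (@lebesgue_measure R).-integrable `[a, y] (EFin \o f).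
  exact: continuous_integrable.
pose F y := \int[@lebesgue_measure R]_(t in `[a, y]) f t.
have F0 y : y \in `]a, b[ -> F y = 0.
  rewrite in_itv/= => /andP[ay yb]; apply/eqP; rewrite eq_le -{1}intf0 /F.
  rewrite Rintegral_ge0// andbT -subr_ge0 (Rintegral_itvB (fi b)) ?bnd_simp;
    [exact: Rintegral_ge0|exact: ltW|exact: ltW].
have xab' := xab; move: xab'; rewrite in_itv/= => /andP[ax xb].
have [||_ <-] := @continuous_FTC1 _ f (BLeft a) x b xb (fi b).
- by rewrite lte_fin.
- exact: cf.
rewrite derive1E; apply/derive_val.
apply: (@near_eq_is_derive _ _ _ (cst 0)).
near=> y; rewrite -/(F y) F0//.
near: y; exact: near_in_itvoo.
Unshelve. all: by end_near. Qed.

(** * The Kalman condition *)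

Lemma mulmx_expmx_eq0 (R : realType) (p q n : nat) (A : 'M[R]_n)
    (W : 'M[R]_(p, n)) (Q : 'M[R]_(n, q)) (t : R) :
  (forall k, W *m A ^+ k *m Q = 0) -> W *m expmx (t *: A) *m Q = 0.
Proof.
move=> WQ0; apply/matrixP => i j.
have /cvg_lim <-// := @cvg_pseries_expmx _ _ _ _ A W Q i j t.
rewrite mxE; apply/cvg_lim => //; apply: cvg_near_cst; apply: nearW => N.
by rewrite /pseries /series/= big1// => k _; rewrite WQ0 mxE mulr0 mul0r.
Qed.

Lemma mulmx_integral_cV (R : realType) (p n : nat) (W : 'M[R]_(p, n))
    (a b : R) (f : R -> 'cV[R]_n) :
  (forall i, (@lebesgue_measure R).-integrable `[a, b]
    (EFin \o (fun s => f s i ord0))) ->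
  W *m integral_cV a b f = integral_cV a b (fun s => W *m f s).
Proof.
move=> fi; apply/colP => i; rewrite !mxE.
under [RHS]eq_Rintegral do rewrite mxE.
by rewrite Rintegral_sumZ//; apply: eq_bigr => j _; rewrite mxE.
Qed.

Lemma integrable_response (R : realType) (n m : nat) (A : 'M[R]_n)
    (B : 'M[R]_(n, m)) (t0 t1 : R) (U : R -> 'cV[R]_m) i :
  L2_control t0 t1 U ->
  (@lebesgue_measure R).-integrable `[t0, t1]
    (EFin \o (fun s => (expmx ((t1 - s) *: A) *m (B *m U s)) i ord0)).
Proof.
move=> UL2; pose g l s := (1%:M *m expmx ((t1 - s) *: A) *m B) i l * U s l ord0.
rewrite [X in EFin \o X](_ : _ = fun s => \sum_l 1 * g l s); last first.
  apply/funext => s; rewrite mulmxA mxE; apply: eq_bigr => l _.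
  by rewrite /g mul1mx mul1r.
apply: integrable_sumZ => // l.
apply: integrable_continuousM; first exact: continuous_expmx_backward.
by apply: square_integrable_integrable; have [] := UL2 l.
Qed.

(** Such a [v] annihilates every state reachable from the origin in unit time,
    that is, every vector. *)
Lemma controllable_kalman_eq0 (R : realType) (n m : nat) (A : 'M[R]_n)
    (B : 'M[R]_(n, m)) (v : 'rV[R]_n) :
  controllable A B -> (forall k, v *m A ^+ k *m B = 0) -> v = 0.
Proof.
move=> ctrlAB vAkB.
have veB t : v *m expmx (t *: A) *m B = 0 by exact: mulmx_expmx_eq0.
have vx (x : 'cV_n) : v *m x = 0.
  have [U [UL2 <-]] := ctrlAB 0 1 ltr01 0 x.
  rewrite /solution mulmx0 add0r mulmx_integral_cV; last first.
    by move=> i; exact: integrable_response.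
  apply/colP => i; rewrite !mxE.
  under eq_Rintegral do rewrite !mulmxA veB mul0mx mxE.
  by rewrite Rintegral_cst// mul0r.
(* Evaluation on the basis vectors reads off the coordinates of [v]. *)
apply/rowP => j; have /colP/(_ ord0) := vx (delta_mx j ord0).
by rewrite -colE !mxE.
Qed.

Section reachability_gramian.
Context (R : realType) (n m : nat) (A : 'M[R]_n) (B : 'M[R]_(n, m)).
Variables (t0 t1 : R).
Hypothesis t01 : t0 < t1.

Let E (s : R) : 'M[R]_(n, m) := expmx ((t1 - s) *: A) *m B.

Definition gramian : 'M[R]_n :=
  \matrix_(i, j) \int[@lebesgue_measure R]_(s in `[t0, t1]) (E s *m (E s)^T) i
    j.

Let continuous_mulE (p : nat) (P : 'M[R]_(p, n)) i l :
  continuous (fun s => (P *m E s) i l).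
Proof.
rewrite (_ : (fun s => _) = (fun s => (P *m expmx ((t1 - s) *: A) *m B) i l)).
  exact: continuous_expmx_backward.
by apply/funext => s; rewrite /E mulmxA.
Qed.

Let continuous_E i l : continuous (fun s => E s i l).
Proof.
rewrite (_ : (fun s => _) = (fun s => (1%:M *m E s) i l)).
  exact: continuous_mulE.
by apply/funext => s; rewrite mul1mx.
Qed.

Let continuous_sumM (I : finType) (f g : I -> R -> R) :
  (forall i, continuous (f i)) -> (forall i, continuous (g i)) ->
  continuous (fun s => \sum_i f i s * g i s).
Proof.
move=> cf cg; apply: continuous_big => [|i _]; first exact: add_continuous.
by move=> s; apply: cvgM; [exact: cf|exact: cg].
Qed.

Let continuous_EE i j : continuous (fun s => (E s *m (E s)^T) i j).
Proof.
rewrite (_ : (fun s => _) = (fun s => \sum_l E s i l * E s j l)).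
  by apply: continuous_sumM => l; exact: continuous_E.
by apply/funext => s; rewrite mxE; apply: eq_bigr => l _; rewrite [_^T _ _]mxE.
Qed.

Lemma gramian_mul (y : 'cV[R]_n) :
  gramian *m y = integral_cV t0 t1 (fun s => E s *m (E s)^T *m y).
Proof.
apply/colP => i; rewrite !mxE.
under [RHS]eq_Rintegral do (rewrite mxE; under eq_bigr do rewrite mulrC).
rewrite Rintegral_sumZ//; last first.
  by move=> j; apply: continuous_integrable; exact: continuous_EE.
by apply: eq_bigr => j _; rewrite mxE mulrC.
Qed.

(** [v G v^T] is the integral of the squared norm of [v E(s)]. *)
Lemma gramian_ker (v : 'rV[R]_n) :
  v *m gramian = 0 -> {in `]t0, t1[, forall s, v *m E s = 0}.
Proof.
move=> vG; pose f s := \sum_l (v *m E s) ord0 l ^+ 2.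
have f_ge0 s : 0 <= f s by apply: sumr_ge0 => l _; exact: sqr_ge0.
have cf : continuous f.
  by apply: continuous_sumM => l; exact: continuous_mulE.
have intf0 : \int[@lebesgue_measure R]_(s in `[t0, t1]) f s = 0.
  have /matrixP/(_ ord0 ord0) : v *m gramian *m v^T = 0 by rewrite vG mul0mx.
  rewrite -mulmxA gramian_mul mulmx_integral_cV; last first.
    move=> i; rewrite [X in EFin \o X](_ : _ = fun s =>
      \sum_l E s i l * (v *m E s) ord0 l); last first.
      apply/funext => s; rewrite -mulmxA -trmx_mul mxE.
      by apply: eq_bigr => l _; rewrite [_^T _ _]mxE.
    apply: continuous_integrable.
    by apply: continuous_sumM => l; [exact: continuous_E|exact:
      continuous_mulE].
  rewrite !mxE => <-; apply: eq_Rintegral => s _.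
  rewrite -mulmxA -trmx_mul mulmxA mxE.
  by apply: eq_bigr => l _; rewrite [_^T _ _]mxE.
move=> s /(Rintegral_eq0_continuous t01 cf f_ge0 intf0) fs0.
apply/rowP => l; rewrite [RHS]mxE; apply/eqP; rewrite -sqrf_eq0; apply/eqP.
by apply: (psumr_eq0P _ fs0) => // k _; exact: sqr_ge0.
Qed.

(** Differentiating [v A^k E(s) = 0] in [s] gives [v A^(k+1) E(s) = 0] on the
    open interval, and [E(t1) = B]. *)
Lemma gramian_ker_kalman (v : 'rV[R]_n) (k : nat) :
  v *m gramian = 0 -> v *m A ^+ k *m B = 0.
Proof.
move=> vG; pose h k l s := (v *m A ^+ k *m expmx ((t1 - s) *: A) *m B) ord0 l.
have h0 l : {in `]t0, t1[, forall s, h k l s = 0}.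
  elim: k => [|k IH] s s01.
    have /rowP/(_ l) := gramian_ker vG s01.
    by rewrite /E /h expr0 mulmx1 mulmxA !mxE.
  have /@derive_val := is_derive_expmx_backward A (v *m A ^+ k) B ord0 l t1 s.
  rewrite -(mulmxA v) mulmxE -exprSr -/(h k.+1 l s).
  rewrite (_ : 'D_1 _ s = 0) => [/esym/eqP|]; first by rewrite oppr_eq0 => /eqP.
  apply: derive_val; apply: (@near_eq_is_derive _ _ _ (cst 0)).
  near=> y; rewrite -/(h k l y) IH//.
  by near: y; exact: near_in_itvoo.
apply/rowP => l; rewrite [RHS]mxE.
have ht1 : h k l t1 = (v *m A ^+ k *m B) ord0 l.
  by rewrite /h subrr expmx0 mulmx1.
rewrite -ht1; have hcvg : h k l s @[s --> t1^'-] --> h k l t1.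
  by apply: cvg_at_left_filter; exact: continuous_expmx_backward.
apply: (cvg_unique _ hcvg) => //; apply: cvg_near_cst.
near=> s; apply: h0; rewrite in_itv/=; apply/andP; split.
  by near: s; exact: nbhs_left_gt.
by near: s; exact: nbhs_left_lt.
Unshelve. all: by end_near. Qed.

(** The control [E(s)^T y] moves the state by [G y]; this is the classical
    control of least energy. *)
Lemma gramian_controllable_on : gramian \in unitmx -> controllable_on A B t0 t1.
Proof.
move=> uG x0 x1.
have [y Gy] : exists y, gramian *m y = x1 - expmx ((t1 - t0) *: A) *m x0.
  by exists (invmx gramian *m (x1 - expmx ((t1 - t0) *: A) *m x0)); rewrite
    mulKVmx.
exists (fun s => (E s)^T *m y); split.
  move=> i.
  have cU : continuous (fun s => ((E s)^T *m y) i ord0).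
    rewrite (_ : (fun s => _) = fun s => \sum_l E s l i * y l ord0).
      by apply: continuous_sumM => l; [exact: continuous_E|move=> s; exact:
        cvg_cst].
    by apply/funext => s; rewrite mxE; apply: eq_bigr => l _; rewrite [_^T _
      _]mxE.
  split.
    by apply: measurable_funTS; exact:
      measurable_realfun.continuous_measurable_fun.
  by apply: continuous_integrable => s; apply: cvgM; exact: cU.
rewrite /solution; under [X in integral_cV _ _ X]eq_fun do rewrite !mulmxA -/(E
  _).
by rewrite -gramian_mul Gy addrC subrK.
Qed.

End reachability_gramian.

Theorem controllableP (R : realType) (n m : nat) (A : 'M[R]_n)
    (B : 'M[R]_(n, m)) :
  controllable A B <->
  (forall v : 'rV[R]_n, (forall k, v *m A ^+ k *m B = 0) -> v = 0).
Proof.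
split=> [ctrlAB v|obs t0 t1 t01]; first exact: controllable_kalman_eq0.
apply: gramian_controllable_on; rewrite -row_free_unit -kermx_eq0.
apply/rowV0P => v /sub_kermxP vG.
by apply: obs => k; exact: gramian_ker_kalman vG.
Qed.

(** * The satellite *)

Lemma sum_ord6 (R : realType) (F : 'I_6 -> R) :
  \sum_i F i = F (inord 0) + F (inord 1) + F (inord 2) + F (inord 3) +
    F (inord 4) + F (inord 5).
Proof.
rewrite !big_ord_recr big_ord0 /= add0r.
by do !congr (_ + _); congr F; apply/val_inj; rewrite /= inordK.
Qed.

(** The three entries of [A] that are not small integers are kept folded,
    so that simplification leaves their decimal expansions alone. Subscripts
    count rows and columns from 1. *)
Definition a21 (R : realType) : R := satA R (inord 1) (inord 0).
Definition a42 (R : realType) : R := satA R (inord 3) (inord 1).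
Definition a65 (R : realType) : R := satA R (inord 5) (inord 4).

Lemma mul_satA (R : realType) (v : 'rV[R]_6) :
  [/\ (v *m satA R) ord0 (inord 0) = v ord0 (inord 1) * a21 R,
      (v *m satA R) ord0 (inord 1) =
        v ord0 (inord 0) + v ord0 (inord 3) * a42 R,
      (v *m satA R) ord0 (inord 2) = 0 &
  [/\ (v *m satA R) ord0 (inord 3) = v ord0 (inord 1) * 2 + v ord0 (inord 2),
      (v *m satA R) ord0 (inord 4) = v ord0 (inord 5) * a65 R &
      (v *m satA R) ord0 (inord 5) = v ord0 (inord 4)]].
Proof.
rewrite /a21 /a42 /a65.
by do !split; rewrite [LHS]mxE sum_ord6 !mxE !inordK //=;
  rewrite ?(mulr0, mulr1, addr0, add0r).
Qed.

Lemma a21_neq0 (R : realType) : a21 R != 0.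
Proof.
have pos (a k : nat) : (0 < a)%N -> 0 < a%:R / 10 ^+ k :> R.
  by move=> a0; rewrite divr_gt0 ?exprn_gt0 ?ltr0n.
apply: lt0r_neq0; rewrite /a21 mxE.
rewrite inordK; last by []. rewrite inordK; last by [].
rewrite /=.
do !apply: addr_gt0; [exact: ltr01|exact: pos..].
Qed.

Definition thrust_index (d : direction) : 'I_6 :=
  match d with
  | dir_r => inord 1
  | dir_theta => inord 3
  | dir_z => inord 5
  end.

Lemma mul_satB_eq0 (R : realType) (S : {set direction}) (v : 'rV[R]_6) :
  v *m satB R S = 0 <-> (forall d, d \in S -> v ord0 (thrust_index d) = 0).
Proof.
have vb d : (v *m thrust_vector R d) ord0 ord0 = v ord0 (thrust_index d).
  by case: d; rewrite -colE mxE.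
have vB j : (v *m satB R S) ord0 j = v ord0 (thrust_index (enum_val j)).
  by rewrite -vb !mxE; apply: eq_bigr => i _; rewrite mxE.
split=> [vB0 d dS|v0]; last first.
  by apply/rowP => j; rewrite vB v0 ?mxE//; exact: enum_valP.
have /rowP/(_ (enum_rank_in dS d)) := vB0.
by rewrite vB enum_rankK_in// mxE.
Qed.

(** [X4' = a42 X2] and [X1' = X2], so [X4 - a42 X1] is conserved: the row
    vector [w] below satisfies [w A = 0]. *)
Lemma not_controllable_without_theta (R : realType) (S : {set direction}) :
  dir_theta \notin S -> ~ controllable (satA R) (satB R S).
Proof.
move=> thS /controllableP obs.
pose w : 'rV[R]_6 := \row_j
  match nat_of_ord j with 0 => - a42 R | 3 => 1 | _ => 0 end.
have wA : w *m satA R = 0.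
  have [w0 w1 w2 [w3 w4 w5]] := mul_satA w.
  apply/rowP => j; rewrite -(inord_val j) [RHS]mxE.
  by case: j => -[|[|[|[|[|[|i]]]]]] lj //=;
    rewrite ?(w0, w1, w2, w3, w4, w5) ?mxE ?inordK //= ?mul0r ?mul1r ?addr0
      ?add0r ?addNr.
have /rowP/(_ (inord 3)) : w = 0.
  apply: obs => -[|k]; last by rewrite exprS -mulmxE mulmxA wA !mul0mx.
  rewrite expr0 mulmx1; apply/mul_satB_eq0 => -[] dS; rewrite mxE inordK//.
  by rewrite dS in thS.
by rewrite !mxE inordK//= => /eqP; rewrite oner_eq0.
Qed.

(** [(X5, X6)] is decoupled from [X1, ..., X4]: the first four
    coordinates of [e5^T A^k] are zero, so only a thruster along z is seen. *)
Lemma not_controllable_without_z (R : realType) (S : {set direction}) :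
  dir_z \notin S -> ~ controllable (satA R) (satB R S).
Proof.
move=> zS /controllableP obs.
pose w : 'rV[R]_6 := delta_mx ord0 (inord 4).
have wA k : [/\ (w *m satA R ^+ k) ord0 (inord 0) = 0,
    (w *m satA R ^+ k) ord0 (inord 1) = 0,
    (w *m satA R ^+ k) ord0 (inord 2) = 0 &
    (w *m satA R ^+ k) ord0 (inord 3) = 0].
  elim: k => [|k [IH0 IH1 IH2 IH3]].
    by rewrite expr0 mulmx1; split; rewrite /w mxE eqxx -val_eqE/= !inordK.
  rewrite exprSr -mulmxE mulmxA.
  have [-> -> -> [-> _ _]] := mul_satA (w *m satA R ^+ k).
  by rewrite IH0 IH1 IH2 IH3 !mul0r addr0.
have /rowP/(_ (inord 4)) : w = 0.
  apply: obs => k; apply/mul_satB_eq0 => -[] dS.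
  - by have [] := wA k.
  - by have [] := wA k.
  - by rewrite dS in zS.
by rewrite /w !mxE !eqxx => /eqP; rewrite oner_eq0.
Qed.

(** Coordinates 4 and 6 of [v A^k] vanish for all [k] by hypothesis. Comparing
    [v A^k] with [v A^(k+1) = (v A^k) A] spreads this to the others in the order
    5, 3 (in terms of 2), 1, and lastly 2, where [a21 != 0] is used. *)
Lemma controllable_with_theta_z (R : realType) (S : {set direction}) :
  dir_theta \in S -> dir_z \in S -> controllable (satA R) (satB R S).
Proof.
move=> thS zS; apply/controllableP => v vAB.
have v3 k : (v *m satA R ^+ k) ord0 (inord 3) = 0.
  by have /mul_satB_eq0/(_ _ thS) := vAB k.
have v5 k : (v *m satA R ^+ k) ord0 (inord 5) = 0.
  by have /mul_satB_eq0/(_ _ zS) := vAB k.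
have step k : v *m satA R ^+ k.+1 = v *m satA R ^+ k *m satA R.
  by rewrite exprSr -mulmxE mulmxA.
have v4 k : (v *m satA R ^+ k) ord0 (inord 4) = 0.
  have [_ _ _ [_ _ <-]] := mul_satA (v *m satA R ^+ k).
  by rewrite -step.
have v12 k : (v *m satA R ^+ k) ord0 (inord 2) =
    - ((v *m satA R ^+ k) ord0 (inord 1) * 2).
  have [_ _ _ [+ _ _]] := mul_satA (v *m satA R ^+ k).
  by rewrite -step v3 => /esym/eqP; rewrite addr_eq0 => /eqP ->; rewrite opprK.
(* Column 3 of [A] is zero, so coordinate 3 vanishes from [k = 1] on. *)
have v1S k : (v *m satA R ^+ k.+1) ord0 (inord 1) = 0.
  have [_ _ w2 _] := mul_satA (v *m satA R ^+ k).
  have := v12 k.+1; rewrite {1}step w2 => /esym/eqP.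
  by rewrite oppr_eq0 mulf_eq0 pnatr_eq0 orbF => /eqP.
have v0 k : (v *m satA R ^+ k) ord0 (inord 0) = 0.
  have [_ + _ _] := mul_satA (v *m satA R ^+ k).
  by rewrite -step v1S v3 mul0r addr0.
have v1 k : (v *m satA R ^+ k) ord0 (inord 1) = 0.
  have [/esym/eqP + _ _ _] := mul_satA (v *m satA R ^+ k).
  by rewrite -step v0 mulf_eq0 (negbTE (a21_neq0 R)) orbF => /eqP.
move: (v0 0) (v1 0) (v12 0) (v3 0) (v4 0) (v5 0).
rewrite expr0 mulmx1 => w0 w1 w2 w3 w4 w5.
apply/rowP => j; rewrite -(inord_val j) [RHS]mxE.
by case: j => -[|[|[|[|[|[|i]]]]]] lj //=; rewrite w2 w1 mul0r oppr0.
Qed.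

Local Close Scope classical_set_scope.

Theorem mainTheorem1 (R : realType) :
  ~ controllable (satA R) (satB R [set dir_r]) /\
  ~ controllable (satA R) (satB R [set dir_theta]) /\
  ~ controllable (satA R) (satB R [set dir_z]) /\
  ~ controllable (satA R) (satB R [set dir_r; dir_theta]) /\
  ~ controllable (satA R) (satB R [set dir_r; dir_z]) /\
  controllable (satA R) (satB R [set dir_theta; dir_z]) /\
  controllable (satA R) (satB R [set dir_r; dir_theta; dir_z]).
Proof.
(* Equality of directions passes through locked ordinals, so that equality
   tests between constructors do not reduce by computation. *)
have neq (d d' : direction) : d <> d' -> (d == d') = false by move/eqP/negbTE.
have inS := (finset.in_setU, finset.in_set1, eqxx, neq).
split; first by apply: not_controllable_without_theta; rewrite !inS.
split; first by apply: not_controllable_without_z; rewrite !inS.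
split; first by apply: not_controllable_without_theta; rewrite !inS.
split; first by apply: not_controllable_without_z; rewrite !inS.
split; first by apply: not_controllable_without_theta; rewrite !inS.
by split; apply: controllable_with_theta_z; rewrite !inS.
Qed.
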